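(* For every integer $k\geq 3$ there are positive constants $c=c(k)$ and $c'=c'(k)$ such that $$2^{c'n^{k-2}\log n}\;\geq\; r_k(k+1,3;n)\;\geq\; 2^{c\,n^{k-2}}.$$
   Context: A $k$-uniform hypergraph ($k$-graph) is a collection of $k$-element subsets (edges) of a vertex set; $K^k_N$ denotes the complete $k$-graph on $N$ vertices. For integers $2\le k<s<n$ and $2\le t\le\binom{s}{k}$, $r_k(s,t;n)$ denotes the minimum $N$ such that every red/blue coloring of the edges of $K^k_N$ yields either an $n$-vertex set all of whose $k$-subsets are blue, or a set of $s$ vertices containing at least $t$ red $k$-subsets. *)

(* Defs.v *)
From mathcomp Require Import all_boot.
From mathcomp Require Import boolp.
Set Implicit Arguments.
Unset Strict Implicit.
Unset Printing Implicit Defensive.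

Section HypergraphRamsey.
Variables (k s t n : nat).

Section Coloring.
Variable N : nat.

Definition edge (e : {set 'I_N}) : bool := #|e| == k.

(* A red/blue coloring of the edges of K^k_N: [f e] is true when e is red.
   The values of f on sets that are not edges are never used. *)
Definition coloring := {ffun {set 'I_N} -> bool}.

Definition red_edges_in (f : coloring) (S : {set 'I_N}) : {set {set 'I_N}} :=
  [set e : {set 'I_N} | [&& e \subset S, edge e & f e]].

Definition has_blue_clique (f : coloring) : bool :=
  [exists S : {set 'I_N}, (#|S| == n) &&
     [forall e : {set 'I_N}, (e \subset S) && edge e ==> ~~ f e]].

Definition has_red_spot (f : coloring) : bool :=
  [exists S : {set 'I_N}, (#|S| == s) && (t <= #|red_edges_in f S|)].

End Coloring.

Definition ramsey_arrow (N : nat) : bool :=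
  [forall f : coloring N, has_blue_clique f || has_red_spot f].

(* r_k(s, t; n), the least N with [ramsey_arrow N]; the junk value 0 is taken
   if there is no such N, so a positive lower bound entails existence. *)
Definition ramsey_number : nat :=
  if pselect (exists N, ramsey_arrow N) is left exN then ex_minn exN else 0.

End HypergraphRamsey.

(* Main.v *)
(* Upper bound. Grow a blue clique S against a reservoir W in which every vertex
   forms only blue edges with the (k-1)-subsets of S. Pick v in W. If for some
   (k-2)-subset d of S the set R of those w in W with d + v + w red is a sizeable
   fraction of W, replace W by R: since a (k+1)-set contains at most two red
   edges, all edges d + w + w' with w, w' in R are then blue, so d never has to
   be considered again, and this happens at most C(n, k-2) times. Otherwise
   move v to S and delete all these sets R from W. Hence a reservoir of
   (C(n, k-2) + 2) ^ (n + C(n, k-2)) vertices suffices.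

   Lower bound. Orient every (k-1)-set at random and colour a k-set red when the
   orientations of its facets agree with one of its two orientations (for k = 3:
   cyclic triangles of a random tournament). At most two facets of a (k+1)-set
   are red. Every n-set contains of order n^(k-1) k-subsets without common
   facets, and these are red independently with constant probability, so that a
   given n-set is a blue clique with probability exp(- c n^(k-1)); a union bound
   over the at most N^n such sets gives N >= exp(c n^(k-2)). *)
Require Import Defs.
From mathcomp Require Import all_boot all_order all_algebra.
From mathcomp Require Import boolp reals sequences exp.
From mathcomp Require Import zify ring.
Set Implicit Arguments.
Unset Strict Implicit.
Unset Printing Implicit Defensive.

(** * Upper bound: the greedy reservoir argument *)

Lemma three_red_edges (k N : nat) (f : coloring N) (V e1 e2 e3 : {set 'I_N}) :
    ~~ has_red_spot k k.+1 3 f -> #|V| = k.+1 ->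
    e1 \subset V -> e2 \subset V -> e3 \subset V ->
    #|e1| = k -> #|e2| = k -> #|e3| = k ->
    e1 != e2 -> e1 != e3 -> e2 != e3 -> f e1 -> f e2 -> ~~ f e3.
Proof.
move=> /existsPn/(_ V) nred cV s1 s2 s3 c1 c2 c3 n12 n13 n23 f1 f2.
apply/negP => f3; move: nred; rewrite cV eqxx /= -ltnNge ltnS leqNgt => /negP; apply.
have <- : #|[set e1; e2; e3]| = 3.
  by rewrite -setUA cardsU1 cards2 !inE negb_or n12 n13 n23.
apply/subset_leq_card/subsetP => e; rewrite !inE /edge.
by case/orP => [/orP[]|] /eqP->; rewrite ?s1 ?s2 ?s3 ?c1 ?c2 ?c3 ?f1 ?f2 ?f3 eqxx.
Qed.

(* [D] records the [K]-sets [d] for which every [w |: (w' |: d)], with [w], [w'] in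
   the reservoir [W], is known to be blue. *)
Lemma blue_clique_from_reservoir (K n N j : nat) (f : coloring N)
    (S W : {set 'I_N}) (D : {set {set 'I_N}}) :
  ~~ has_red_spot K.+2 K.+3 3 f ->
  [disjoint S & W] -> #|S| <= n ->
  D \subset [set d : {set 'I_N} | d \subset S & #|d| == K] ->
  (n - #|S|) + ('C(n, K) - #|D|) <= j ->
  ('C(n, K) + 2) ^ j <= #|W| ->
  (forall e : {set 'I_N}, e \subset S -> #|e| = K.+2 -> ~~ f e) ->
  (forall (e : {set 'I_N}) w, e \subset S -> #|e| = K.+1 -> w \in W -> ~~ f (w |: e)) ->
  (forall d w w', d \in D -> w \in W -> w' \in W -> w != w' ->
     ~~ f (w |: (w' |: d))) ->
  has_blue_clique K.+2 n f.
Proof.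
move=> nred; set B := 'C(n, K); set M := B + 2.
(* [j] bounds the rounds left: each round enlarges [S] or [D], and at 0 the set [S] must have size
   [n]. *)
elim: j S W D => [|j IH] S W D dSW leS sD lej leW blueS blueSW blueD.
all: have [eqS | neS] := eqVneq #|S| n.
1,3: by apply/existsP; exists S; rewrite eqS eqxx; apply/forallP => e;
  apply/implyP => /andP[sE /eqP cE]; apply: blueS.
  by lia.
have ltS : #|S| < n by lia.
have M_gt0 : 0 < M by rewrite /M; lia.
have leMW : M * M ^ j <= #|W| by rewrite -expnS.
have : 0 < #|W| by apply: leq_trans leMW; rewrite muln_gt0 expn_gt0 M_gt0.
case/card_gt0P => v vW.
have vS : v \notin S by move: dSW => /pred0P/(_ v) /=; rewrite vW andbT => ->.
pose R d := [set w in W :\ v | f (w |: (v |: d))].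
pose L := [set d : {set 'I_N} | d \subset S & #|d| == K].
have cL : #|L| <= B by rewrite cards_draws leq_bin2l.
have sRW d : R d \subset W by apply/subsetP => w; rewrite !inE => /andP[/andP[]].
have [/existsP[d /andP[/andP[dL dD] leR]] | smallR] :=
  boolP [exists d, (d \in L) && (d \notin D) && (#|W| <= M * #|R d|)].
  have sD' : d |: D \subset L by rewrite subUset sub1set dL.
  have cD' : #|d |: D| = #|D|.+1 by rewrite cardsU1 dD.
  have := subset_leq_card sD'; rewrite cD' => ltD.
  move: (dL); rewrite inE => /andP[sdS /eqP cd].
  have notd w : w \in W -> w \notin d.
    move=> wW; apply/negP => /(subsetP sdS) wS.
    by move: dSW => /pred0P/(_ w) /=; rewrite wS wW.
  apply: (IH S (R d) (d |: D)) => //.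
  - exact: disjointWr (sRW d) dSW.
  - by rewrite cD'; lia.
  - by rewrite -(leq_pmul2l M_gt0); apply: leq_trans leR.
  - by move=> e w sE cE /(subsetP (sRW d)); apply: blueSW.
  move=> d' w w' /setU1P[->|d'D] wR w'R ww'; last first.
    by apply: blueD => //; apply: (subsetP (sRW d)).
  have /setIdP[/setD1P[wv wW] fw] := wR.
  have /setIdP[/setD1P[w'v w'W] fw'] := w'R.
  have vd := notd v vW; have wd := notd w wW; have w'd := notd w' w'W.
  (* Among these [K.+3] vertices, the edges omitting [w'] and [w] are red, so the edge omitting [v]
     is blue. *)
  apply: (three_red_edges (V := v |: (w |: (w' |: d))) nred _ _ _ _ _ _ _ _ _ _ fw fw').
  - by rewrite !cardsU1 !inE !negb_or vd wd w'd ww' eq_sym wv eq_sym w'v cd.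
  - by rewrite setUCA; apply: setUS; apply: setUS; apply: subsetUr.
  - by rewrite setUCA; apply: setUS; apply: subsetUr.
  - exact: subsetUr.
  - by rewrite !cardsU1 !inE negb_or vd wd wv cd.
  - by rewrite !cardsU1 !inE negb_or vd w'd w'v cd.
  - by rewrite !cardsU1 !inE negb_or ww' wd w'd cd.
  - by apply/eqP => /setP/(_ w); rewrite !inE eqxx (negPf ww') (negPf wv) (negPf wd).
  - by apply/eqP => /setP/(_ v); rewrite !inE eqxx (negPf vd) ![v == _]eq_sym
      (negPf wv) (negPf w'v).
  - by apply/eqP => /setP/(_ v); rewrite !inE eqxx (negPf vd) ![v == _]eq_sym
      (negPf wv) (negPf w'v).
(* Each of these at most [B] sets has fewer than [#|W| / M] elements, so deleting all of them costs
   at most the fraction [B / M] of [W]. *)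
pose U := \bigcup_(d in L :\: D) R d.
have leU : M * #|U| <= B * #|W|.
  apply: (@leq_trans (\sum_(d in L :\: D) M * #|R d|)).
    rewrite -big_distrr /= leq_mul2l; apply/orP; right.
    rewrite /U; elim/big_rec2: _ => [|d m X _ le]; first by rewrite cards0.
    by apply: leq_trans (leq_card_setU _ _) _; rewrite leq_add2l.
  apply: (@leq_trans (\sum_(d in L :\: D) #|W|)).
    apply: leq_sum => d; rewrite inE => /andP[dD dL].
    by move/existsPn/(_ d): smallR; rewrite dL dD /= -ltnNge => /ltnW.
  rewrite sum_nat_const leq_mul2r; apply/orP; right.
  by apply: leq_trans cL; apply: subset_leq_card; apply: subsetDl.
have leWU : #|W| <= (#|(W :\ v) :\: U|).+1 + #|U|.
  have := cardsD1 v W; rewrite vW => ->; rewrite add1n addSn ltnS.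
  by rewrite -(cardsID U (W :\ v)) addnC leq_add2l subset_leq_card ?subsetIr.
apply: (IH (v |: S) ((W :\ v) :\: U) D).
- rewrite disjoint_sym disjoints_subset; apply/subsetP => w.
  rewrite !inE negb_or => /andP[_ /andP[-> wW]] /=; apply/negP => wS.
  by move: dSW => /pred0P/(_ w) /=; rewrite wS wW.
- by rewrite cardsU1 vS.
- apply: subset_trans sD _; apply/subsetP => d; rewrite !inE => /andP[sd ->].
  by rewrite andbT; apply: subset_trans sd (subsetUr _ _).
- by rewrite cardsU1 vS; lia.
(* Why [M = B + 2]: the new reservoir [W'] satisfies [2 * #|W| <= M * #|W'| + M], and one copy of
   [#|W|] absorbs the last [M], the cost of removing [v]. *)
- rewrite -(leq_pmul2l M_gt0).
  have : M * #|W| <= M * (#|(W :\ v) :\: U|).+1 + B * #|W|.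
    by apply: leq_trans (leq_mul (leqnn M) leWU) _; rewrite mulnDr leq_add2l.
  have : M <= #|W| by apply: leq_trans leMW; rewrite leq_pmulr // expn_gt0 M_gt0.
  have -> : M * #|W| = B * #|W| + #|W| + #|W| by rewrite /M; lia.
  by rewrite mulnS; lia.
- move=> e sE cE; have [ve | ve] := boolP (v \in e).
    rewrite -(setD1K ve); apply: blueSW => //; first by rewrite subDset.
    by have := cardsD1 v e; rewrite ve cE => -[].
  apply: blueS => //; rewrite -(setU1K vS); apply/subsetP => x xe.
  rewrite in_setD1 (subsetP sE) // andbT.
  by apply: contraNneq ve => <-.
- move=> e w sE cE; rewrite inE => /andP[wU wW].
  move: (wW); rewrite !inE => /andP[wv wW'].
  have [ve | ve] := boolP (v \in e); last first.
    apply: blueSW => //; rewrite -(setU1K vS); apply/subsetP => x xe.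
    rewrite in_setD1 (subsetP sE) // andbT.
    by apply: contraNneq ve => <-.
  have cd : #|e :\ v| = K by have := cardsD1 v e; rewrite ve cE => -[].
  have sd : e :\ v \subset S by rewrite subDset.
  (* For [d = e :\ v] in [D] the invariant applies; otherwise [R d] was deleted together with
     [U]. *)
  rewrite -(setD1K ve); have [dD | dD] := boolP (e :\ v \in D).
    exact: blueD.
  apply/negP => fw; move/negP: wU; apply; apply/bigcupP; exists (e :\ v).
    by rewrite inE dD inE sd cd /=.
  by rewrite inE wW.
- move=> d w w' dD; rewrite !inE => /andP[_ /andP[_ wW]] /andP[_ /andP[_ w'W]].
  exact: blueD.
Qed.

Lemma ramsey_arrow_upper (K n : nat) :
  ramsey_arrow K.+2 K.+3 3 n (('C(n, K) + 2) ^ (n + 'C(n, K))).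
Proof.
apply/forallP => f; rewrite orbC; have [//|nred] := boolP (has_red_spot _ _ _ f).
apply: (@blue_clique_from_reservoir K n _ (n + 'C(n, K)) f set0 setT set0) => //.
- by rewrite disjoints_subset sub0set.
- by rewrite cards0.
- by rewrite sub0set.
- by rewrite !cards0 !subn0.
- by rewrite cardsT card_ord.
- by move=> e; rewrite subset0 => /eqP->; rewrite cards0.
- by move=> e w; rewrite subset0 => /eqP->; rewrite cards0.
- by move=> d w w'; rewrite inE.
Qed.

(** * Lower bound: coherent sets of an orientation and their frequency *)

Section Coherent.
Variable N : nat.
Implicit Types (T V : {set 'I_N}) (F : {set {set 'I_N}}).

(** For [v] in [T] this is the position of [v]; its parity is the sign of the facet [T :\ v] in the
    simplicial boundary. *)
Definition below T (v : 'I_N) := #|[set u in T | u < v]|.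

(* [g] orients every set of vertices relative to the increasing order; [T] is
   coherent when its facets are oriented as the boundary of [T] or of [- T]. *)
Definition coherent (g : {ffun {set 'I_N} -> bool}) T :=
  [exists s : bool, [forall v in T, g (T :\ v) == s (+) odd (below T v)]].

(** The sign rule behind the vanishing of the double boundary: exactly one of [i], [j] lies below
    the other, so the two removals change exactly one position, by one. *)
Lemma odd_belowD1 V i j : i \in V -> j \in V -> i != j ->
  odd (below (V :\ i) j) (+) odd (below (V :\ j) i)
    = ~~ (odd (below V i) (+) odd (below V j)).
Proof.
have step a b : a \in V -> below V b = (a < b) + below (V :\ a) b.
  move=> aV; rewrite /below (cardsD1 a) !inE aV /=; congr (_ + _).
  by apply: eq_card => u; rewrite !inE andbA.
move=> iV jV nij; rewrite (step i j iV) (step j i jV) !oddD !oddb.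
by have : (i : nat) != j := nij; case: ltngtP => //= _ _; do 2 case: odd.
Qed.

(** The two facets share [V :\ i :\ j], and the single value of [g] there links their signs. *)
Lemma coherentD1_pair (g : {ffun {set 'I_N} -> bool}) V i j (s s' : bool) :
    i \in V -> j \in V -> i != j ->
    [forall v in V :\ i, g (V :\ i :\ v) == s (+) odd (below (V :\ i) v)] ->
    [forall v in V :\ j, g (V :\ j :\ v) == s' (+) odd (below (V :\ j) v)] ->
  s (+) s' = ~~ (odd (below V i) (+) odd (below V j)).
Proof.
move=> iV jV nij /forall_inP/(_ j) Hi /forall_inP/(_ i) Hj.
rewrite -odd_belowD1 //.
have /eqP : g (V :\ i :\ j) == s (+) odd (below (V :\ i) j).
  by apply: Hi; rewrite !inE eq_sym nij.
have /eqP : g (V :\ j :\ i) == s' (+) odd (below (V :\ j) i).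
  by apply: Hj; rewrite !inE nij.
have -> : V :\ j :\ i = V :\ i :\ j by rewrite !setDDl setUC.
by move=> ->; clear Hi Hj; do 2 case: odd; case: s; case: s'.
Qed.

(* Each pair of signs is opposed up to the parities of the two positions, so the
   three relations multiply to [-1]. *)
Lemma no_three_coherent (g : {ffun {set 'I_N} -> bool}) V i j l :
  i \in V -> j \in V -> l \in V -> i != j -> i != l -> j != l ->
  coherent g (V :\ i) -> coherent g (V :\ j) -> coherent g (V :\ l) -> False.
Proof.
move=> iV jV lV nij nil njl /existsP[a Ha] /existsP[b Hb] /existsP[c Hc].
have := coherentD1_pair iV jV nij Ha Hb.
have := coherentD1_pair iV lV nil Ha Hc.
have := coherentD1_pair jV lV njl Hb Hc.
by case: a {Ha}; case: b {Hb}; case: c {Hc}; do 3 case: odd.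
Qed.

Definition coherent_coloring (g : {ffun {set 'I_N} -> bool}) : coloring N :=
  [ffun T => coherent g T].

Lemma subset_facet k T V : T \subset V -> #|T| = k -> #|V| = k.+1 ->
  exists2 i, i \in V & T = V :\ i.
Proof.
move=> sTV cT cV; have /cards1P[i Ei] : #|V :\: T| == 1.
  by rewrite cardsDS // cT cV subSnn.
exists i; first by have := set11 i; rewrite -Ei => /setDP[].
by rewrite -Ei setDDr setDv set0U; apply/esym/setIidPr.
Qed.

Lemma coherent_coloring_no_red_spot k g :
  ~~ has_red_spot k k.+1 3 (coherent_coloring g).
Proof.
apply/existsPn => V; apply/negP => /andP[/eqP cV].
move=> /card_gt2P[T1 [T2 [T3 [[]]]]].
rewrite !inE !ffunE.
move=> /and3P[s1 /eqP c1 g1] /and3P[s2 /eqP c2 g2] /and3P[s3 /eqP c3 g3] [].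
have [i iV E1] := subset_facet s1 c1 cV; have [j jV E2] := subset_facet s2 c2 cV.
have [l lV E3] := subset_facet s3 c3 cV; subst => n12 n23 n31.
apply: (no_three_coherent iV jV lV _ _ _ g1 g2 g3).
- by apply: contraNneq n12 => ->.
- by apply: contraNneq n31 => ->.
- by apply: contraNneq n23 => ->.
Qed.

Definition incoherent_on F : {set {ffun {set 'I_N} -> bool}} :=
  [set g : {ffun {set 'I_N} -> bool} | [forall T in F, ~~ coherent g T]].

(* Overwriting the facets of [T] makes [T] coherent, does not affect [F], and
   forgets only the values on the facets. *)
Lemma card_incoherent_coherent k F T : #|T| = k ->
    (forall T', T' \in F -> forall x y, x \in T' -> y \in T -> T' :\ x != T :\ y) ->
  #|incoherent_on F| <= #|incoherent_on F :&: [set g | coherent g T]| * 2 ^ k.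
Proof.
move=> cT dT.
pose P := [set T :\ v | v in T].
pose ow (g : {ffun {set 'I_N} -> bool}) : {ffun {set 'I_N} -> bool} :=
  [ffun e => if [pick v in T | e == T :\ v] is Some v then odd (below T v) else g e].
have owT g v : v \in T -> ow g (T :\ v) = odd (below T v).
  move=> vT; rewrite ffunE; case: pickP => [w /andP[wT /eqP E]|/(_ v)].
    suff -> : v = w by [].
    by have /setP/(_ v) := E; rewrite !inE eqxx vT /= andbT => /esym/negbFE/eqP.
  by rewrite vT eqxx.
have owN g e : e \notin P -> ow g e = g e.
  move=> eP; rewrite ffunE; case: pickP => // w /andP[wT /eqP E].
  by case/imsetP: eP; exists w.
(* The second component keeps the overwritten values, which makes [h] injective. *)
pose h g := (ow g, [set e in P | g e]).
set A := _ :&: _.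
have h_inj : {in incoherent_on F &, injective h}.
  move=> g g' _ _ [E1 /setP E2]; apply/ffunP => e.
  have [eP | eP] := boolP (e \in P); first by have := E2 e; rewrite !inE eP.
  by rewrite -(owN g) // E1 owN.
rewrite -(card_in_imset h_inj).
have leP : #|powerset P| <= 2 ^ k.
  by rewrite card_powerset leq_exp2l // -cT leq_imset_card.
apply: leq_trans (leq_mul (leqnn _) leP); rewrite -cardsX.
apply/subset_leq_card/subsetP => _ /imsetP[g gF ->].
rewrite !inE /=; apply/andP; split; last first.
  by apply/subsetP => e; rewrite !inE => /andP[].
apply/andP; split; last first.
  apply/existsP; exists false; apply/forall_inP => v vT.
  by rewrite owT.
apply/forall_inP => T' T'F; move: gF; rewrite inE => /forall_inP/(_ T' T'F).
suff -> : coherent (ow g) T' = coherent g T' by [].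
apply: eq_existsb => s; apply: eq_forallb_in => v vT'.
rewrite owN //; apply/imsetP => -[w wT E].
by have := dT T' T'F v w vT' wT; rewrite E eqxx.
Qed.

(** Given incoherence on [F], coherence of [T] has conditional probability at least [2 ^ -k]; this
    is the complementary bound, cleared of denominators. *)
Lemma card_incoherentU1 k F T : #|T| = k ->
    (forall T', T' \in F -> forall x y, x \in T' -> y \in T -> T' :\ x != T :\ y) ->
  #|incoherent_on (T |: F)| * 2 ^ k <= #|incoherent_on F| * (2 ^ k - 1).
Proof.
move=> cT dT; have := card_incoherent_coherent cT dT.
have := cardsID [set g | coherent g T] (incoherent_on F).
have -> : incoherent_on F :\: [set g | coherent g T] = incoherent_on (T |: F).
  apply/setP => g; rewrite !inE; apply/andP/forall_inP => [[nT /forall_inP H] T' |H].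
    by case/setU1P => [->|/H].
  split; first by apply: H; apply: setU11.
  by apply/forall_inP => T' T'F; apply: H; apply: setU1r.
set a := #|_ :&: _|; set b := #|incoherent_on (_ |: _)|; set c := #|_|.
have : 0 < 2 ^ k by rewrite expn_gt0.
move: (2 ^ k) => m m0 <-; nia.
Qed.

Definition facet_disjoint F := forall T T', T \in F -> T' \in F -> T != T' ->
  forall x y, x \in T -> y \in T' -> T :\ x != T' :\ y.

Lemma card_incoherent_on k F : (forall T, T \in F -> #|T| = k) -> facet_disjoint F ->
  #|incoherent_on F| * (2 ^ k) ^ #|F| <=
    #|{ffun {set 'I_N} -> bool}| * (2 ^ k - 1) ^ #|F|.
Proof.
move: {2}#|F| (erefl #|F|) => m; elim: m F => [|m IH] F cF uF dF.
  by rewrite cF !expn0 !muln1 max_card.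
have /card_gt0P[T TF] : 0 < #|F| by rewrite cF.
have cF' : #|F :\ T| = m by have := cardsD1 T F; rewrite TF cF => -[].
have sF T' : T' \in F :\ T -> T' \in F by rewrite inE => /andP[].
have {}IH : #|incoherent_on (F :\ T)| * (2 ^ k) ^ m <=
    #|{ffun {set 'I_N} -> bool}| * (2 ^ k - 1) ^ m.
  rewrite -[in X in X <= _]cF' -[in X in _ <= X]cF'; apply: IH => //.
    by move=> T' /sF; apply: uF.
  by move=> T1 T2 /sF ? /sF ?; apply: dF.
have : #|incoherent_on (T |: (F :\ T))| * 2 ^ k
    <= #|incoherent_on (F :\ T)| * (2 ^ k - 1).
  apply: card_incoherentU1; first exact: uF.
  move=> T' T'F x y xT' yT; apply: dF => //; first exact: sF.
  by move: T'F; rewrite !inE => /andP[].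
rewrite setD1K // cF !expnS => step.
apply: (@leq_trans (#|incoherent_on (F :\ T)| * (2 ^ k - 1) * (2 ^ k) ^ m)).
  by rewrite mulnA leq_mul2r step orbT.
by rewrite mulnAC mulnCA mulnC leq_mul2l [X in _ <= X]mulnC; nia.
Qed.

(* The [k]-subsets whose vertex labels have a prescribed sum modulo [n]: any
   [k-1] of the vertices determine the last one. *)
Lemma facet_disjoint_family n k (S : {set 'I_N}) : 0 < n -> #|S| = n ->
  exists F : {set {set 'I_N}},
    [/\ forall T, T \in F -> T \subset S /\ #|T| = k,
        facet_disjoint F & 'C(n, k) <= n * #|F|].
Proof.
move=> n_gt0 cS.
pose lab (x : 'I_N) := index x (enum S).
have lab_lt x : x \in S -> lab x < n by rewrite -cS cardE index_mem mem_enum.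
pose phi (T : {set 'I_N}) : 'I_n := Ordinal (ltn_pmod (\sum_(x in T) lab x) n_gt0).
pose A := [set T : {set 'I_N} | T \subset S & #|T| == k].
pose F r := [set T in A | phi T == r].
have sumF : 'C(n, k) = \sum_(r < n) #|F r|.
  rewrite -[in LHS]cS -cards_draws -sum1_card (partition_big phi predT) //=.
  by apply: eq_bigr => r _; rewrite -sum1_card; apply: eq_bigl => T; rewrite !inE.
(* Pigeonhole over the [n] residue classes. *)
have [r leF] : exists r, 'C(n, k) <= n * #|F r|.
  apply/existsP; apply: contraT => /existsPn H.
  have : \sum_(r < n) n * #|F r| < \sum_(r < n) 'C(n, k).
    rewrite ltn_neqAle; apply/andP; split; last first.
      by apply: leq_sum => r _; apply: ltnW; rewrite ltnNge H.
    rewrite neq_ltn; apply/orP; left.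
    rewrite (bigD1 (Ordinal n_gt0)) //= [X in _ < X](bigD1 (Ordinal n_gt0)) //=.
    rewrite -addSn leq_add //; first by rewrite ltnNge H.
    by apply: leq_sum => r _; apply: ltnW; rewrite ltnNge H.
  by rewrite -big_distrr /= -sumF sum_nat_const card_ord ltnn.
exists (F r); split => // [T|T T'].
  by rewrite !inE => /andP[/andP[? /eqP]].
rewrite !inE => /andP[/andP[sT _] /eqP pT] /andP[/andP[sT' _] /eqP pT'] neT x y xT yT'.
apply: contraNneq neT => E.
have xS := subsetP sT x xT; have yS := subsetP sT' y yT'.
have : phi T = phi T' by rewrite pT pT'.
move/(congr1 val) => /=; rewrite (big_setD1 x xT) (big_setD1 y yT') /= E => /eqP.
rewrite eqn_modDr !modn_small ?lab_lt // => /eqP lxy.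
have xy : x = y.
  by apply: (@index_inj _ x (enum S)) ; rewrite ?mem_enum.
by rewrite -(setD1K xT) E xy setD1K.
Qed.

End Coherent.

(** * Binomial estimates and the union bound *)

Lemma bin_ge_exp n k : k <= n -> n ^ k <= 'C(n, k) * k ^ k.
Proof.
elim: k n => [|k IH] [|n] //; rewrite ltnS => le_kn.
have [-> | k_gt0] := posnP k; first by rewrite bin1 muln1.
have kk : 0 < k ^ k by rewrite expn_gt0 k_gt0.
rewrite [k.+1 ^ _]expnS mulnA [_ * k.+1]mulnC -mul_bin_diag expnS -mulnA.
rewrite leq_mul2l /= -(leq_pmul2r kk) -expnMn.
(* [n.+1 * k <= n * k.+1] because [k <= n]. *)
apply: (@leq_trans ((n * k.+1) ^ k)); first by rewrite leq_exp2r //; lia.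
by rewrite expnMn mulnAC leq_mul2r IH ?orbT.
Qed.

Lemma bin_le_exp n k : 'C(n, k) <= n ^ k.
Proof.
elim: k n => [|k IH] [|n] //.
have : k.+1 * 'C(n.+1, k.+1) <= n.+1 * n.+1 ^ k.
  rewrite -mul_bin_diag leq_mul2l (leq_trans (IH n)) ?orbT //.
  by case: k {IH} => // k; rewrite leq_exp2r.
by rewrite -expnS; apply: leq_trans; rewrite leq_pmull.
Qed.

(** The coloring of any orientation has no red spot, so it has a blue [n]-clique, on which the
    orientation is incoherent. *)
Lemma card_ffun_le_incoherent k n N : ramsey_arrow k k.+1 3 n N ->
  #|{ffun {set 'I_N} -> bool}| <=
    \sum_(S : {set 'I_N} | #|S| == n)
      #|incoherent_on [set T : {set 'I_N} | T \subset S & #|T| == k]|.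
Proof.
move=> /forallP arr.
pose I (S : {set 'I_N}) :=
  incoherent_on [set T : {set 'I_N} | T \subset S & #|T| == k].
apply: (@leq_trans #|\bigcup_(S : {set 'I_N} | #|S| == n) I S|); last first.
  elim/big_rec2: _ => [|S m X _ le]; first by rewrite cards0.
  by apply: leq_trans (leq_card_setU _ _) _; rewrite leq_add2l.
rewrite -cardsT; apply/subset_leq_card/subsetP => g _; apply/bigcupP.
have := arr (coherent_coloring g).
rewrite (negPf (coherent_coloring_no_red_spot _ _)) orbF.
move=> /existsP[S /andP[cS /forallP blue]]; exists S => //.
rewrite inE; apply/forall_inP => T; rewrite inE => sT.
by have := blue T; rewrite /edge sT ffunE.
Qed.

(** * Exponential form of both bounds *)

Section RealEstimates.
Variable R : realType.
Import Order.TTheory GRing.Theory Num.Theory.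
Local Open Scope ring_scope.

(** The exponential rate of the factor [1 - 2 ^ -k] paid for each member of a facet-disjoint
    family. *)
Definition log_decay (k : nat) : R := - ln (1 - (2 ^+ k)^-1).

Lemma decay_itv k : (0 < k)%N -> 0 < (1 - (2 ^+ k)^-1 : R) < 1.
Proof.
move=> k_gt0; rewrite subr_gt0 invf_lt1 ?exprn_gt0 // exprn_egt1 ?ltr1n -?lt0n //.
by rewrite k_gt0 ltrBlDr ltrDl invr_gt0 exprn_gt0.
Qed.

Lemma log_decay_gt0 k : (0 < k)%N -> 0 < log_decay k.
Proof. by move=> k_gt0; rewrite oppr_gt0 ln_lt0 // decay_itv. Qed.

(** Only a facet-disjoint subfamily is kept; it has at least ['C(n, k) / n], hence at least
    [n ^ (k - 1) / k ^ k], members. *)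
Lemma card_incoherent_on_clique k n N (S : {set 'I_N}) :
    (0 < k <= n)%N -> #|S| = n ->
  #|incoherent_on [set T : {set 'I_N} | T \subset S & #|T| == k]|%:R <=
    expR (- log_decay k * (n%:R ^+ k.-1 / k%:R ^+ k)) *
      #|{ffun {set 'I_N} -> bool}|%:R :> R.
Proof.
move=> /andP[k_gt0 le_kn] cS; have n_gt0 : (0 < n)%N by apply: leq_trans le_kn.
have [F [uF dF leF]] := facet_disjoint_family k n_gt0 cS.
have q_itv := decay_itv k_gt0; have /andP[q_gt0 _] := q_itv.
have leIF : #|incoherent_on [set T : {set 'I_N} | T \subset S & #|T| == k]|%:R <=
    #|incoherent_on F|%:R :> R.
  rewrite ler_nat; apply/subset_leq_card/subsetP => g; rewrite !inE => /forall_inP H.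
  by apply/forall_inP => T /uF[sT cT]; apply: H; rewrite inE sT cT /=.
apply: le_trans leIF _.
have cardF : #|incoherent_on F|%:R <=
    (1 - (2 ^+ k)^-1) ^+ #|F| * #|{ffun {set 'I_N} -> bool}|%:R :> R.
  have := card_incoherent_on (fun T TF => proj2 (uF T TF)) dF.
  rewrite -(ler_nat R) !natrM !natrX natrB ?expn_gt0 // natrX => le.
  have p_gt0 : 0 < (2 ^+ k) ^+ #|F| :> R by rewrite !exprn_gt0.
  rewrite -(ler_pM2r p_gt0); apply: le_trans le _.
  rewrite [X in _ <= X]mulrAC [X in X <= _]mulrC ler_wpM2r ?ler0n // -exprMn.
  by rewrite mulrBl mul1r mulVf ?expf_neq0 ?pnatr_eq0.
apply: le_trans cardF _; rewrite ler_wpM2r ?ler0n //.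
rewrite -[X in X ^+ _](lnK q_gt0) -expRM_natr ler_expR /log_decay opprK.
apply: ler_wnM2l; first by rewrite ltW ?ln_lt0.
rewrite ler_pdivrMr ?exprn_gt0 ?ltr0n //.
rewrite -!natrX -natrM ler_nat -(leq_pmul2l n_gt0) -expnS prednK // mulnA.
by apply: leq_trans (bin_ge_exp le_kn) _; rewrite leq_mul2r leF orbT.
Qed.

Lemma ramsey_arrow_lower k n N : (1 < k <= n)%N -> ramsey_arrow k k.+1 3 n N ->
  expR (log_decay k / k%:R ^+ k * n%:R ^+ (k - 2)) <= N%:R.
Proof.
move=> /andP[k_gt1 le_kn] arr; have k_gt0 : (0 < k)%N by apply: ltnW.
have n_gt0 : (0 < n)%N by apply: leq_trans le_kn.
set x := log_decay k * (n%:R ^+ k.-1 / k%:R ^+ k).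
have : 1 <= N%:R ^+ n * expR (- x) :> R.
  have c_gt0 : 0 < #|{ffun {set 'I_N} -> bool}|%:R :> R.
    by rewrite ltr0n; apply/card_gt0P; exists [ffun=> true].
  rewrite -(ler_pM2r c_gt0) mul1r.
  have := card_ffun_le_incoherent arr; rewrite -(ler_nat R) => /le_trans; apply.
  rewrite natr_sum; apply: (@le_trans _ _
    (\sum_(S : {set 'I_N} | #|S| == n)
       expR (- x) * #|{ffun {set 'I_N} -> bool}|%:R)).
    apply: ler_sum => S /eqP cS; rewrite -mulNr; apply: card_incoherent_on_clique => //.
    by rewrite k_gt0.
  rewrite sumr_const -[X in X <= _]mulr_natl mulrA ler_wpM2r //.
  rewrite ler_wpM2r ?expR_ge0 // -natrX ler_nat.
  have -> : #|[pred S : {set 'I_N} | #|S| == n]| = 'C(N, n).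
    by rewrite -[N in 'C(N, _)]card_ord -card_draws cardsE.
  exact: bin_le_exp.
rewrite expRN -ler_pdivrMr ?invr_gt0 ?expR_gt0 // invrK mul1r => le.
(* Taking the [n]-th root of [expR x <= N ^ n] lowers the power of [n] from [k - 1] to [k - 2]. *)
rewrite -(ler_pXn2r n_gt0) ?nnegrE ?expR_ge0 ?ler0n // -expRM_natr.
suff -> : log_decay k / k%:R ^+ k * n%:R ^+ (k - 2) * n%:R = x by [].
rewrite /x -mulrA -exprSr mulrAC -mulrA; congr (_ * (_ ^+ _ / _)).
by rewrite subn2; case: k k_gt1 {k_gt0 le_kn arr x le} => [|[]].
Qed.

(** The base is at most [n ^ K.+1] and the exponent at most [2 * n ^ K]; dividing by [ln 2] passes
    to powers of 2. *)
Lemma reservoir_size_le K n : (0 < K)%N -> (2 < n)%N ->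
  (('C(n, K) + 2) ^ (n + 'C(n, K)))%:R <=
    2 `^ (2 * K.+1%:R / ln 2 * n%:R ^+ K * ln n%:R) :> R.
Proof.
move=> K_gt0 n_gt2; have n_gt0 : (0 < n)%N by apply: leq_trans n_gt2.
have leC := bin_le_exp n K.
have le_n : (n <= n ^ K)%N by rewrite -{1}(expn1 n) leq_exp2l // ltnW.
have leM : ('C(n, K) + 2 <= n ^ K.+1)%N by rewrite expnS; nia.
have : (('C(n, K) + 2) ^ (n + 'C(n, K)) <= (n ^ K.+1) ^ (2 * n ^ K))%N.
  apply: (@leq_trans ((n ^ K.+1) ^ (n + 'C(n, K)))).
    by case: (n + _)%N => // m; rewrite leq_exp2r.
  by rewrite leq_pexp2l ?expn_gt0 ?n_gt0 //; lia.
rewrite -(ler_nat R) => /le_trans; apply.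
rewrite /powR pnatr_eq0 /= -expnM natrX -[X in X ^+ _]lnK ?posrE ?ltr0n //.
rewrite -expRM_natl ler_expR le_eqVlt; apply/orP; left; apply/eqP.
have ln2 : ln 2 != 0 :> R by rewrite gt_eqF // ln_gt0 // ltr1n.
by rewrite !natrM natrX; field.
Qed.

End RealEstimates.

(** A witness [N] rules out the junk value 0. *)
Lemma ramsey_numberP k s t n N : ramsey_arrow k s t n N ->
  ramsey_arrow k s t n (ramsey_number k s t n) /\ ramsey_number k s t n <= N.
Proof.
move=> arr; rewrite /ramsey_number; case: pselect => [ex | []]; last by exists N.
by case: ex_minnP => m am minm; split => //; apply: minm.
Qed.

Import Order.TTheory GRing.Theory Num.Theory.
Local Open Scope ring_scope.

Theorem theorem1p4 (R : realType) (k : nat) (hk : (3 <= k)%N) :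
  exists c c' : R,
    [/\ 0 < c, 0 < c' &
      forall n : nat, (k.+1 < n)%N ->
        2 `^ (c * n%:R ^+ (k - 2)) <= (ramsey_number k k.+1 3 n)%:R :> R
        /\ (ramsey_number k k.+1 3 n)%:R <= 2 `^ (c' * n%:R ^+ (k - 2) * ln n%:R) :> R].
Proof.
have ln2 : 0 < ln 2 :> R by rewrite ln_gt0 // ltr1n.
have k_gt0 : (0 < k)%N by apply: leq_trans hk.
(* These are the constants of [ramsey_arrow_lower], rescaled to base 2, and of [reservoir_size_le]
   at [K = k - 2]. *)
exists (log_decay R k / k%:R ^+ k / ln 2), (2 * (k - 2).+1%:R / ln 2); split.
- by rewrite !divr_gt0 ?log_decay_gt0 ?exprn_gt0 ?ltr0n.
- by rewrite divr_gt0 // mulr_gt0 // ltr0n.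
move=> n lt_kn.
have arr := ramsey_arrow_upper (k - 2) n.
have Ek : (k - 2).+2 = k by rewrite -addn2 subnK // ltnW.
rewrite Ek in arr; have [arrm lem] := ramsey_numberP arr; split.
  rewrite /powR pnatr_eq0 /= mulrAC divfK ?gt_eqF //.
  by apply: ramsey_arrow_lower arrm; rewrite (ltnW hk) /=; lia.
apply: le_trans (reservoir_size_le _ _ _); rewrite ?ler_nat ?subn_gt0 //.
by lia.
Qed.
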